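(* Let $(X,T)$ be a minimal Cantor system, with a fixed sequence $\{\mathcal{P}_n\}_{n\in\mathbb{N}}$ of clopen Kakutani-Rohlin partitions satisfying (KR1)-(KR6) and the normalization of $\mathcal{P}_0,\mathcal{P}_1$ described in the context. Let $\lambda=\exp(2i\pi\alpha)$, $\alpha\in\mathbb{R}$, be a continuous eigenvalue of $(X,T)$. Then $$\max_{x\in X}\big|\langle s_n(x),\,|||\alpha P_nH_1|||\,\rangle\big|\longrightarrow 0\quad\text{as } n\to+\infty,$$ where for a real vector $v$, $|||v|||$ denotes the (signed) difference $v-w$ between $v$ and its closest integer vector $w$ (coordinatewise closest, with the coordinates of $v-w$ in $(-1/2,1/2]$).
   Context: A Cantor system $(X,T)$ is a homeomorphism $T$ of a Cantor space $X$; it is minimal if $X$ has no proper non-empty closed $T$-invariant subset. $\lambda\in\mathbb{C}$ is a continuous eigenvalue if there is a continuous $f:X\to\mathbb{C}$, $f\ne0$, with $f\circ T=\lambda f$. A clopen Kakutani-Rohlin (CKR) partition is a partition $\{T^jB(k): 1\le k\le C,\ 0\le j<h(k)\}$ of $X$ where $C,h(1),\dots,h(C)$ are positive integers and $B(1),\dots,B(C)$ are clopen sets with $\bigcup_k T^{h(k)}B(k)=\bigcup_k B(k)$; its base is $\bigcup_kB(k)$. Let $\mathcal{P}_n=\{T^jB_n(k): 1\le k\le C_n,\ 0\le j<h_n(k)\}$, $n\in\mathbb{N}$, be a sequence of CKR partitions, with bases $B_n$. Normalization: $\mathcal{P}_0$ is trivial ($B_0=X$, $C_0=1$, $h_0(1)=1$)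 and $h_1(k)=1$ for all $1\le k\le C_1$. For all $n\ge0$ assume: (KR1) $B_{n+1}\subseteq B_n$; (KR2) every atom of $\mathcal{P}_{n+1}$ is contained in an atom of $\mathcal{P}_n$; (KR3) $\bigcap_nB_n$ is a single point; (KR4) the sequence of partitions spans the topology of $X$; (KR5) for all $1\le k\le C_n$, $1\le l\le C_{n+1}$ there is $0\le j<h_{n+1}(l)$ with $T^jB_{n+1}(l)\subseteq B_n(k)$; (KR6) $B_{n+1}\subseteq B_n(1)$. Such a sequence always exists. Put $H_n=(h_n(l))_{1\le l\le C_n}$ (a column vector), $M_n=(m_n(l,k))_{1\le l\le C_n,\,1\le k\le C_{n-1}}$ with $m_n(l,k)=\#\{0\le j<h_n(l): T^jB_n(l)\subseteq B_{n-1}(k)\}$, and $P_n=M_nM_{n-1}\cdots M_2$ for $n\ge2$; thus $P_nH_1=H_n$. The entrance time of $x\in X$ to $B_n$ is $r_n(x)=\min\{j\ge0: T^jx\in B_n\}$. The suffix map $s_n:X\to\mathbb{N}^{C_n}$ is defined by $(s_n(x))_k=\#\{j\in\mathbb{N}: 0\le j<r_{n+1}(x),\ T^jx\in B_n(k)\}$, $1\le k\le C_n$. $\langle v,v'\rangle=v^Tv'$ is the usual scalar product. *)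

(* Defs.v *)
From mathcomp Require Import all_boot all_order all_algebra.
From mathcomp Require Import all_classical all_reals all_analysis.
From mathcomp Require Import complex lra.

Set Implicit Arguments.
Unset Strict Implicit.
Unset Printing Implicit Defensive.

Import Order.TTheory GRing.Theory Num.Theory.
Import numFieldNormedType.Exports.

Local Open Scope classical_set_scope.
Local Open Scope ring_scope.

Definition homeomorphism (X Y : topologicalType) (f : X -> Y) : Prop :=
  exists g : Y -> X, [/\ cancel f g, cancel g f, continuous f & continuous g].

(* The library's [cantor_like] does not imply metrizability, so it is not used here. *)
Definition is_cantor_space (X : topologicalType) : Prop :=
  exists f : cantor_space -> X, homeomorphism f.

Definition cantor_system (X : topologicalType) (T : X -> X) : Prop :=
  is_cantor_space X /\ homeomorphism T.

Definition minimal (X : topologicalType) (T : X -> X) : Prop :=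
  forall A : set X, closed A -> A !=set0 -> T @` A = A -> A = setT.

(* [R[i]^o] is [R[i]] seen with the topology of its modulus. *)
Definition continuous_eigenvalue (R : realType) (X : topologicalType)
    (T : X -> X) (lambda : R[i]) : Prop :=
  exists f : X -> R[i]^o,
    [/\ continuous f, f <> (fun=> 0) & forall x, f (T x) = lambda * f x].

Definition exp_2ipi (R : realType) (alpha : R) : R[i] :=
  (cos (2 * pi * alpha) +i* sin (2 * pi * alpha))%C.

(* Towers are indexed from 0: B(k), 1 <= k <= C, has index k - 1 in 'I_C. *)
Record ckr_partition (X : topologicalType) (T : X -> X) := CKRPartition {
  ckr_C : nat ;
  ckr_h : 'I_ckr_C -> nat ;
  ckr_B : 'I_ckr_C -> set X ;
  ckr_C_gt0 : (0 < ckr_C)%N ;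
  ckr_h_gt0 : forall k, (0 < ckr_h k)%N ;
  ckr_B_clopen : forall k, clopen (ckr_B k) ;
  ckr_partitionP :
    partition [set kj : 'I_ckr_C * nat | (kj.2 < ckr_h kj.1)%N]
              (fun kj => iter kj.2 T @` ckr_B kj.1) [set: X] ;
  ckr_top : \bigcup_k (iter (ckr_h k) T @` ckr_B k) = \bigcup_k ckr_B k
}.

Arguments ckr_C {X T} _.
Arguments ckr_h {X T} _ _.
Arguments ckr_B {X T} _ _.

Section CKR.
Context {X : topologicalType} {T : X -> X}.

Definition ckr_base (P : ckr_partition T) : set X := \bigcup_k ckr_B P k.

Definition ckr_atoms (P : ckr_partition T) : set (set X) :=
  [set A | exists k j, (j < ckr_h P k)%N /\
                       A = iter j T @` ckr_B P k].

Definition ckr_first (P : ckr_partition T) : 'I_(ckr_C P) :=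
  Ordinal (ckr_C_gt0 P).

Record KR_sequence (P : nat -> ckr_partition T) : Prop := {
  KR_base0 : ckr_base (P 0%N) = setT ;
  KR_C0 : ckr_C (P 0%N) = 1%N ;
  KR_h0 : forall k, ckr_h (P 0%N) k = 1%N ;
  KR_h1 : forall k, ckr_h (P 1%N) k = 1%N ;
  KR1 : forall n, ckr_base (P n.+1) `<=` ckr_base (P n) ;
  KR2 : forall n A, ckr_atoms (P n.+1) A ->
          exists2 A', ckr_atoms (P n) A' & A `<=` A' ;
  KR3 : exists x, \bigcap_n ckr_base (P n) = [set x] ;
  KR4 : basis (\bigcup_n ckr_atoms (P n)) ;
  KR5 : forall n k l, exists2 j, (j < ckr_h (P n.+1) l)%N &
          iter j T @` ckr_B (P n.+1) l `<=` ckr_B (P n) k ;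
  KR6 : forall n, ckr_base (P n.+1) `<=` ckr_B (P n) (ckr_first (P n))
}.

Lemma ckr_base_reached (P : ckr_partition T) (x : X) :
  exists j, `[< ckr_base P (iter j T x) >].
Proof.
have [cov _ _] := ckr_partitionP P.
have : [set: X] x by [].
rewrite -cov => -[[k j] /= jh [y By <-]].
exists (ckr_h P k - j)%N; apply/asboolP; rewrite -iterD subnK ?(ltnW jh)//.
by rewrite /ckr_base -ckr_top; exists k => //; exists y.
Qed.

Definition entrance_time (P : ckr_partition T) (x : X) : nat :=
  ex_minn (ckr_base_reached P x).

Section Sequence.
Variable P : nat -> ckr_partition T.

Definition kr_H n : 'cV[nat]_(ckr_C (P n)) := \col_l ckr_h (P n) l.

Definition kr_M n : 'M[nat]_(ckr_C (P n), ckr_C (P n.-1)) :=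
  \matrix_(l, k)
    #|[pred j : 'I_(ckr_h (P n) l)
       | `[< iter j T @` ckr_B (P n) l `<=` ckr_B (P n.-1) k >]]|.

(* [kr_prod n] is M_(n+1) ... M_2, with the empty product 1 at n = 0. *)
Fixpoint kr_prod n : 'M[nat]_(ckr_C (P n.+1), ckr_C (P 1%N)) :=
  if n is m.+1 then kr_M m.+2 *m kr_prod m else 1%:M.

(* P_n = M_n ... M_2 for n >= 2; the value at n = 0 is irrelevant. *)
Definition kr_P n : 'M[nat]_(ckr_C (P n), ckr_C (P 1%N)) :=
  if n is m.+1 then kr_prod m else 0.

Definition suffix_map n (x : X) : 'cV[nat]_(ckr_C (P n)) :=
  \col_k #|[pred j : 'I_(entrance_time (P n.+1) x)
            | `[< ckr_B (P n) k (iter j T x) >]]|.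

End Sequence.
End CKR.

Section Vectors.
Context {R : realType}.

Definition is_max (X : Type) (f : X -> R) (m : R) : Prop :=
  (exists x, f x = m) /\ (forall x, f x <= m).

Definition nat_mx {m n} (A : 'M[nat]_(m, n)) : 'M[R]_(m, n) :=
  map_mx (fun a => a%:R) A.

Definition dot {n} (v w : 'cV[R]_n) : R := (v^T *m w) 0 0.

(* The integer closest to [x], the smaller one in case of a tie. *)
Definition closest_int (x : R) : int := Num.ceil (x - 2^-1).

Lemma closest_intP (x : R) : - 2^-1 < x - (closest_int x)%:~R <= 2^-1.
Proof.
rewrite /closest_int; set c := Num.ceil _.
have := ceil_itv (x - 2^-1); rewrite -/c intrD => /andP[h1 h2].
apply/andP; split; [rewrite ltrBrDl|rewrite lerBlDl]; lra.
Qed.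

Definition dist_int_vec {n} (v : 'cV[R]_n) : 'cV[R]_n :=
  v - map_mx (fun x => (closest_int x)%:~R) v.

End Vectors.

(* Main.v *)
Require Import Defs.
From mathcomp Require Import all_boot all_order all_algebra.
From mathcomp Require Import all_classical all_reals all_analysis.
From mathcomp Require Import complex.
From mathcomp Require Import lra.
Import Order.TTheory GRing.Theory Num.Theory.
Import numFieldNormedType.Exports.
Local Open Scope classical_set_scope.
Local Open Scope ring_scope.

(** Write |||t||| for the signed distance from [t] to its closest integer and
    let [f] be an eigenfunction for exp(2 i pi alpha). By minimality [f]
    vanishes nowhere, and by (KR3), (KR4) and (KR6) the bases B_n shrink to a
    point, so [f] is nearly constant on B_n. Since f (T^m x) is
    exp(2 i pi alpha m) f x, every time [m] separating two visits of an orbit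
    to B_n satisfies |alpha m - integer| < d as soon as [n] is large, uniformly
    in the orbit and in [m] ([return_sdist_lt]).

    Up to an integer, <s_n x, |||alpha H_n||| > is alpha <s_n x, H_n>, and
    <s_n x, H_n> = r_(n+1) x - r_n x is the time separating two visits to B_n
    ([sum_visits_height]): hence the scalar product is close to some integer.
    The point is that this integer is 0. Follow the orbit of [x] backwards from
    its entrance in B_(n+1). The scalar product starts at 0 and changes only
    when the orbit meets some B_n(k), by |||alpha h_n(k)|||, which is itself
    less than [d] because h_n(k) is a return time to B_n. If 3 d <= 1, a
    quantity that starts at 0, moves by steps less than [d] and always stays
    within [d] of the integers never leaves the [d]-neighbourhood of 0
    ([sum_visits_sdist_lt]).

    It remains that P_n H_1 = H_n ([kr_P_height]), and that the maximum is
    attained because s_n takes finitely many values ([suffix_is_max]). *)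

(** * Towers, entrance times and visits *)

Section OnePartition.
Context {X : topologicalType} {T : X -> X}.
Variable P : ckr_partition T.
Implicit Types (x y : X) (k l : 'I_(ckr_C P)) (N : nat).

Lemma ckr_atom_inj k l i j x y :
  (i < ckr_h P k)%N -> (j < ckr_h P l)%N -> ckr_B P k x -> ckr_B P l y ->
  iter i T x = iter j T y -> k = l /\ i = j.
Proof.
move=> ik jl Bx By xy; have [_ triv _] := ckr_partitionP P.
have /(triv (k, i) (l, j) ik jl)[-> ->//] :
  iter i T @` ckr_B P k `&` iter j T @` ckr_B P l !=set0.
by exists (iter i T x); split; [exists x | exists y].
Qed.

Lemma ckr_tower_inj {k l x} : ckr_B P k x -> ckr_B P l x -> k = l.
Proof.
move=> kx lx; have [] // := ckr_atom_inj k l 0%N 0%N x x _ _ kx lx.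
all: exact: ckr_h_gt0.
Qed.

Lemma ckr_tower_nonempty k : ckr_B P k !=set0.
Proof.
have [_ _ /(_ (k, 0%N) (ckr_h_gt0 k))] := ckr_partitionP P.
by move=> [_ [x kx _]]; exists x.
Qed.

Lemma ckr_return {k x} : ckr_B P k x -> ckr_base P (iter (ckr_h P k) T x).
Proof. by move=> kx; rewrite /ckr_base -ckr_top; exists k => //; exists x. Qed.

Lemma entrance_time_in x : ckr_base P (iter (entrance_time P x) T x).
Proof. by rewrite /entrance_time; case: ex_minnP => m /asboolP. Qed.

Lemma entrance_time_min {j x} :
  ckr_base P (iter j T x) -> (entrance_time P x <= j)%N.
Proof.
move=> jx; rewrite /entrance_time; case: ex_minnP => m _; apply.
exact/asboolP.
Qed.

Lemma entrance_time_base x : ckr_base P x -> entrance_time P x = 0%N.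
Proof. by move=> Bx; apply/eqP; rewrite -leqn0 (@entrance_time_min 0%N). Qed.

Lemma entrance_time_notin x :
  ~ ckr_base P x -> entrance_time P x = (entrance_time P (T x)).+1.
Proof.
move=> nBx; apply/eqP; rewrite eqn_leq; apply/andP; split.
  by apply: entrance_time_min; rewrite iterSr; exact: entrance_time_in.
have := entrance_time_in x; case: entrance_time => [//|j].
by rewrite iterSr ltnS => /entrance_time_min.
Qed.

(** Up to its return time h(k), the orbit of a point of B(k) climbs through
    levels that are disjoint from the base. *)
Lemma entrance_time_tower {k x} :
  ckr_B P k x -> (entrance_time P (T x)).+1 = ckr_h P k.
Proof.
move=> kx; apply/eqP; rewrite eqn_leq; apply/andP; split.
  rewrite -(prednK (ckr_h_gt0 k)) ltnS; apply: entrance_time_min.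
  by rewrite -iterSr prednK ?ckr_h_gt0//; exact: ckr_return.
rewrite leqNgt; apply/negP => lt_h.
have [l _ ly] := entrance_time_in (T x); rewrite -iterSr in ly.
have [_] := @ckr_atom_inj k l _ 0 x _ lt_h (ckr_h_gt0 l) kx ly erefl.
by [].
Qed.

Lemma entrance_time_bounded x :
  (entrance_time P x <= \max_k ckr_h P k)%N.
Proof.
have [cov _ _] := ckr_partitionP P.
have : [set: X] x by [].
rewrite -cov => -[[k j] /= jh [y ky <-]].
apply: leq_trans (leq_bigmax k); apply: leq_trans (leq_subr j _).
by apply: entrance_time_min; rewrite -iterD subnK ?(ltnW jh)//; exact: ckr_return.
Qed.

(** The coordinates of the suffix map, for an orbit segment of arbitrary
    length. *)
Definition visits N x k : nat :=
  (\sum_(j < N) `[< ckr_B P k (iter j T x) >])%N.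

Lemma visits0 x k : visits 0 x k = 0%N.
Proof. by rewrite /visits big_ord0. Qed.

Lemma visitsS N x k :
  visits N.+1 x k = (`[< ckr_B P k x >] + visits N (T x) k)%N.
Proof.
rewrite /visits big_ord_recl/=; congr addn.
by apply: eq_bigr => j _; rewrite -iterSr.
Qed.

Lemma visits_le N x k : (visits N x k <= N)%N.
Proof.
rewrite -[leqRHS]card_ord -sum1_card; apply: leq_sum => j _.
exact: leq_b1.
Qed.

Lemma sum_visitsS_notin (V : nmodType) (w : 'I_(ckr_C P) -> V) N x :
  ~ ckr_base P x ->
  \sum_k w k *+ visits N.+1 x k = \sum_k w k *+ visits N (T x) k.
Proof.
move=> nBx; apply: eq_bigr => k _; rewrite visitsS asboolF//.
by move=> kx; apply: nBx; exists k.
Qed.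

Lemma sum_visitsS_in {V : nmodType} {w : 'I_(ckr_C P) -> V} {N x k} :
  ckr_B P k x ->
  \sum_l w l *+ visits N.+1 x l = w k + \sum_l w l *+ visits N (T x) l.
Proof.
move=> kx; rewrite [in LHS](bigD1 k)// [in RHS](bigD1 k)//= addrA.
congr (_ + _); first by rewrite visitsS asboolT// add1n mulrS.
apply: eq_bigr => l /eqP lk; rewrite visitsS asboolF// => lx.
exact: lk (ckr_tower_inj lx kx).
Qed.

(** The segment of length [N] first waits for the base and is then a
    concatenation of complete towers, since it stops at a visit to the base.
    Taking for [N] an entrance time or a tower height of the next partition
    gives <s_n, H_n> = r_(n+1) - r_n and M_(n+1) H_n = H_(n+1). *)
Lemma sum_visits_height N x : ckr_base P (iter N T x) ->
  ((\sum_k ckr_h P k *+ visits N x k)%R + entrance_time P x)%N = N.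
Proof.
elim: N x => [|N IH] x BN.
  by rewrite entrance_time_base// addn0 big1// => k _; rewrite visits0.
rewrite iterSr in BN; have {IH} := IH _ BN => IH.
have [[k _ kx]|nBx] := pselect (ckr_base P x).
  rewrite (sum_visitsS_in kx) entrance_time_base; last by exists k.
  rewrite -(entrance_time_tower kx) addn0 -[RHS](congr1 S IH).
  by rewrite addrC; exact: addnS.
by rewrite sum_visitsS_notin// entrance_time_notin// addnS IH.
Qed.

End OnePartition.

(** * Distance to the nearest integer *)

Section NearestInteger.
Context {R : realType}.
Implicit Types t a d : R.

(** One coordinate of [dist_int_vec]. *)
Definition sdist t : R := t - (closest_int t)%:~R.

Lemma sdist_le_half t : `|sdist t| <= 2^-1.
Proof.
have /andP[lt le] := closest_intP t.
by rewrite ler_norml; apply/andP; split; [exact: ltW|].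
Qed.

Lemma int_norm_lt1 (c : int) : `|c%:~R : R| < 1 -> c = 0.
Proof. by rewrite -intr_norm -[1]/(1%:~R) ltr_int; case: c => [[|n]|n]. Qed.

Lemma sum_sdist (I : finType) (a : R) (h v : I -> nat) :
  exists z : int, \sum_k sdist (a * (h k)%:R) *+ v k =
                  a * (\sum_k h k *+ v k)%R%:R - z%:~R.
Proof.
exists (\sum_k closest_int (a * (h k)%:R) *+ v k).
rewrite natr_sum mulr_sumr rmorph_sum/= -sumrB; apply: eq_bigr => k _.
have -> : (closest_int (a * (h k)%:R) *+ v k)%:~R =
    (closest_int (a * (h k)%:R))%:~R *+ v k :> R.
  exact: (raddfMn (intmul 1 : int -> R)).
have -> : ((h k *+ v k)%R%:R : R) = (h k)%:R *+ v k.
  exact: (raddfMn (GRing.natmul 1 : nat -> R)).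
by rewrite mulrnBl -mulrnAr.
Qed.

Lemma cosD2piz (x : R) (z : int) : cos (x + (pi *+ 2) * z%:~R) = cos x.
Proof.
have cosn (n : nat) y : cos (y + (pi *+ 2) * n%:R) = cos y :> R.
  by rewrite mulr_natr periodicn//; exact: cosD2pi.
case: z => n; first by rewrite cosn.
by rewrite NegzE mulrNz mulrN -pmulrn -[LHS](cosn n.+1) subrK.
Qed.

Lemma cos_sdist t : cos (2 * pi * `|sdist t|) = cos (2 * pi * t).
Proof.
have -> : 2 * pi * `|sdist t| = `|2 * pi * sdist t|.
  by rewrite normrM gtr0_norm// mulr_gt0// pi_gt0.
have -> : 2 * pi * t = 2 * pi * sdist t + pi *+ 2 * (closest_int t)%:~R.
  by rewrite -[pi *+ 2]mulr_natl -mulrDr /sdist subrK.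
by rewrite cosD2piz cos_norm.
Qed.

Lemma exp_2ipiX a m : exp_2ipi a ^+ m = exp_2ipi (a * m%:R).
Proof.
elim: m => [|m IH]; first by rewrite mulr0 /exp_2ipi mulr0 cos0 sin0.
rewrite exprS IH /exp_2ipi -[in RHS](natr1 m) (mulrDr a) mulr1 mulrDr addrC cosD sinD.
by apply/eqP; rewrite eq_complex/= eqxx /= addrC [X in X + _]mulrC [X in _ + X]mulrC.
Qed.

Lemma norm_exp_2ipi a : `|exp_2ipi a| = 1.
Proof. by rewrite normc_def/= cos2Dsin2 sqrtr1. Qed.

(** Since 1 - cos (2 pi t) <= |exp (2 i pi t) - 1| and cosine decreases on
    [0, pi], the constant 1 - cos (2 pi d) works. *)
Lemma sdist_lt_of_exp d : 0 < d -> d <= 2^-1 ->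
  exists2 e : R, 0 < e &
    forall t, `|exp_2ipi t - 1| < e%:C%C -> `|sdist t| < d.
Proof.
move=> d0 d2; have pi0 := pi_gt0 R.
have dom (u : R) : 0 <= u <= 2^-1 -> 2 * pi * u \in `[0, pi]%R.
  move=> /andP[u0 u2]; rewrite in_itv/= !mulr_ge0 ?(ltW pi0)//=.
  by rewrite mulrAC ger_pMl//; lra.
exists (1 - cos (2 * pi * d)).
  rewrite subr_gt0 -[ltRHS]cos0 ltr_cos.
  - by rewrite !mulr_gt0.
  - by rewrite in_itv/= lexx ltW.
  - by apply: dom; rewrite ltW.
move=> t te; have dt := sdist_le_half t.
have : 1 - cos (2 * pi * t) < 1 - cos (2 * pi * d).
  rewrite -ltcR; apply: le_lt_trans te.
  apply: (le_trans _ (normc_ge_Re _)); rewrite lecR /= -normrN opprB.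
  exact: ler_norm.
rewrite ltrD2l ltrN2 -(cos_sdist t) ltr_cos.
- by rewrite ltr_pM2l// mulr_gt0.
- by apply: dom; rewrite normr_ge0.
- by apply: dom; rewrite ltW.
Qed.

End NearestInteger.

(** * The scalar product stays near 0 *)

(** The hypothesis on return times bounds both the steps |||a h(k)||| and the
    distance to the integers of the whole sum. In the induction the sum is less
    than [2 * d] in absolute value and within [d] of an integer, which is then
    0 because [3 * d <= 1]. *)
Lemma sum_visits_sdist_lt {R : realType} {X : topologicalType} {T : X -> X}
    (P : ckr_partition T) (a d : R) :
  0 < d -> d <= 3^-1 ->
  (forall x m, ckr_base P x -> ckr_base P (iter m T x) ->
     `|sdist (a * m%:R)| < d) ->
  forall N x, ckr_base P (iter N T x) ->
    `|\sum_k sdist (a * (ckr_h P k)%:R) *+ visits P N x k| < d.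
Proof.
move=> d0 d3 close_return; elim=> [|N IH] x BN.
  by rewrite big1 ?normr0// => k _; rewrite visits0.
have {IH} := IH (T x); rewrite -iterSr => /(_ BN) IH.
have [Bx|nBx] := pselect (ckr_base P x); last by rewrite sum_visitsS_notin.
have lt_d := close_return _ _ Bx BN.
have [k _ kx] := Bx.
have wk : `|sdist (a * (ckr_h P k)%:R)| < d.
  by apply: close_return Bx _; exact: ckr_return.
have lt_2d : `|\sum_k sdist (a * (ckr_h P k)%:R) *+ visits P N.+1 x k| < d + d.
  rewrite (sum_visitsS_in _ kx); apply: le_lt_trans (ler_normD _ _) _.
  exact: ltrD.
have [z Ez] := sum_sdist _ a (ckr_h P) (visits P N.+1 x).
have := sum_visits_height _ _ _ BN.
rewrite entrance_time_base// addn0 => EN; rewrite EN in Ez.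
(* [z0] says that the sum is exactly the signed distance of [a * N.+1]. *)
suff z0 : closest_int (a * N.+1%:R) - z = 0.
  rewrite Ez; move: lt_d; rewrite /sdist; congr (`|_ - _| < _).
  by move/eqP: z0; rewrite subr_eq0 => /eqP ->.
apply: (@int_norm_lt1 R); rewrite intrD.
have -> : (closest_int (a * N.+1%:R))%:~R + (- z)%:~R =
  \sum_k sdist (a * (ckr_h P k)%:R) *+ visits P N.+1 x k - sdist (a * N.+1%:R).
  by rewrite Ez /sdist mulrNz; lra.
apply: le_lt_trans (ler_normB _ _) _.
lra.
Qed.

(** * Shrinking bases and tower heights *)

Section Sequence.
Context {X : topologicalType} {T : X -> X}.
Variables (P : nat -> ckr_partition T) (hP : KR_sequence P).

Lemma ckr_base_nonincreasing m n :
  (m <= n)%N -> ckr_base (P n) `<=` ckr_base (P m).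
Proof.
move=> /subnK <-; elim: (n - m)%N => [//|i IH].
by apply: subset_trans IH; exact: KR1.
Qed.

(** Some atom of some P_n contains [x] and lies in [U]. As [x] is in
    B_(n+1), hence in B_n(1), this atom is B_n(1), which contains all the
    later bases. *)
Lemma ckr_base_shrink x (U : set X) :
  (forall n, ckr_base (P n) x) -> nbhs x U ->
  exists n, forall m, (n <= m)%N -> ckr_base (P m) `<=` U.
Proof.
move=> Bx Ux; have [_ /(_ x U Ux)[V [[n _ [k [j [jk VE]]]] Vx] VU]] := KR4 hP.
exists n.+1 => m nm; apply: subset_trans VU.
apply: subset_trans (ckr_base_nonincreasing _ _ nm) _.
move: Vx; rewrite VE => -[y ky yx].
have x1 := KR6 hP (Bx n.+1).
have [-> ->] := ckr_atom_inj (P n) _ _ j 0%N y x jk (ckr_h_gt0 _) ky x1 yx.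
by move=> z /(KR6 hP) z1; exists z.
Qed.

Lemma suffix_mapE n x k :
  suffix_map P n x k 0 = visits (P n) (entrance_time (P n.+1) x) x k.
Proof.
rewrite mxE -sum1_card big_mkcond; apply: eq_bigr => j _.
by rewrite inE; case: asbool.
Qed.

(** The height of a tower of P_(n+1) is a return time to B_n of any of its base
    points; by (KR2) a level meeting B_n(k) is included in it, so the visits of
    that point count the entries of the incidence matrix. *)
Lemma kr_M_height n : kr_M P n.+1 *m kr_H P n = kr_H P n.+1.
Proof.
apply/colP => l; rewrite !mxE.
have [x lx] := ckr_tower_nonempty (P n.+1) l.
have Bx : ckr_base (P n) x by apply: (KR1 hP); exists l.
have Bh := KR1 hP (ckr_return _ lx).
rewrite -[RHS](sum_visits_height _ _ _ Bh) entrance_time_base// addn0.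
apply: eq_bigr => k _; rewrite !mxE mulrC -[in RHS]mulr_natr natn; congr (_ * _).
rewrite -sum1_card big_mkcond; apply: eq_bigr => j _.
rewrite inE; set b := asbool _; set c := asbool _.
suff -> : b = c by case: c.
apply/asboolP/asboolP => [|kj]; first by apply; exists x.
have : ckr_atoms (P n.+1) (iter j T @` ckr_B (P n.+1) l) by exists l, j.
move=> /(KR2 hP)[_ [k' [i [ik' ->]] sub]].
have [y k'y yx] := sub _ (imageP (iter j T) lx).
have [<- i0] := ckr_atom_inj (P n) _ _ _ 0%N _ _ ik' (ckr_h_gt0 k) k'y kj yx.
by move: sub; rewrite i0 image_id.
Qed.

Lemma kr_P_height n : kr_P P n.+1 *m kr_H P 1 = kr_H P n.+1.
Proof.
elim: n => [|n IH]; first by rewrite /= mul1mx.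
by rewrite -[RHS]kr_M_height -IH mulmxA.
Qed.

End Sequence.

(** * Return times and eigenfunctions *)

(** The zero set is closed and invariant, hence empty or the whole space. *)
Lemma eigenfunction_neq0 {R : realType} {X : topologicalType} {T : X -> X}
    (lambda : R[i]) (f : X -> R[i]^o) :
  homeomorphism T -> minimal T -> lambda != 0 -> continuous f ->
  f <> (fun=> 0) -> (forall x, f (T x) = lambda * f x) -> forall x, f x != 0.
Proof.
move=> [S [TK SK _ _]] minT l0 cf f0 fT x; apply/eqP => fx0; apply: f0.
suff Z : f @^-1` [set 0] = setT.
  by apply/funext => y; have : [set: X] y by []; rewrite -Z.
apply: minT.
- apply: preimage_closed; first by move=> y _; exact: cf.
  by apply: accessible_closed_set1; apply: hausdorff_accessible; exact: norm_hausdorff.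
- by exists x.
- apply/seteqP; split => [_ [y /= fy <-]|y /= fy]; first by rewrite /= fT fy mulr0.
  exists (S y); last exact: SK.
  apply/eqP; move: fy; rewrite -{1}(SK y) fT => /eqP.
  by rewrite mulf_eq0 (negPf l0).
Qed.

(** If [x] and [T^N x] are both in a base on which [f] is within [eta] of
    [f x0], then |lambda^N - 1| |f x0| < 2 eta. *)
Lemma return_sdist_lt {R : realType} {X : topologicalType} {T : X -> X}
    (P : nat -> ckr_partition T) (alpha d : R) :
  homeomorphism T -> minimal T -> KR_sequence P ->
  continuous_eigenvalue T (exp_2ipi alpha) -> 0 < d ->
  exists n, forall m, (n <= m)%N -> forall x N,
    ckr_base (P m) x -> ckr_base (P m) (iter N T x) ->
    `|sdist (alpha * N%:R)| < d.
Proof.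
move=> homT minT hP [f [cf f0 fT]] d0.
set lambda := exp_2ipi alpha in fT.
have lambda1 : `|lambda| = 1 by exact: norm_exp_2ipi.
have lambda0 : lambda != 0 by rewrite -normr_gt0 lambda1.
have [x0 capE] := KR3 hP.
have Bx0 n : ckr_base (P n) x0.
  by have : [set x0] x0 by []; rewrite -capE; apply.
have fx0 : 0 < `|f x0|.
  by rewrite normr_gt0; exact: (eigenfunction_neq0 _ _ homT minT lambda0 cf f0 fT).
have fiter N x : f (iter N T x) = lambda ^+ N * f x.
  elim: N => [|N IH]; first by rewrite mul1r.
  by rewrite iterS fT IH exprS mulrA.
have [e e0 he] : exists2 e : R, 0 < e &
    forall t, `|exp_2ipi t - 1| < e%:C%C -> `|sdist t| < d.
  (* Beyond 1/2 the bound on the signed distance is trivial. *)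
  have [d2|d2] := leP d 2^-1; first exact: sdist_lt_of_exp.
  by exists 1 => // t _; exact: le_lt_trans (sdist_le_half t) d2.
pose eta : R[i] := (e%:C)%C * `|f x0| / 2.
have eta0 : 0 < eta by rewrite !mulr_gt0// ltcR.
have [n hn] := ckr_base_shrink _ hP _ _ Bx0 (cvgr_dist_lt _ _ (cf x0) _ eta0).
exists n => m nm x N Bx BNx; apply: he; rewrite -exp_2ipiX -/lambda.
rewrite -(ltr_pM2r fx0) -normrM.
(* [f (iter N T x)] is [lambda ^+ N * f x]: compare both values with [f x0]. *)
have -> : (lambda ^+ N - 1) * f x0 =
    lambda ^+ N * (f x0 - f x) - (f x0 - f (iter N T x)).
  by rewrite fiter mulrBr mulrBl mul1r opprB addrA subrK.
apply: le_lt_trans (ler_normB _ _) _.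
rewrite normrM normrX lambda1 expr1n mul1r.
rewrite [ltRHS](splitr _); apply: ltrD; exact: hn nm _ _.
Qed.

(** * The maximum and its limit *)

Lemma finite_range_is_max {R : realType} {X : Type} (I : finType) (g : X -> I)
    (F : I -> R) (x0 : X) : exists m, is_max (fun x => F (g x)) m.
Proof.
pose Q i := `[< exists x, g x = i >].
have Q0 : Q (g x0) by apply/asboolP; exists x0.
case: (arg_maxP F Q0) => i /asboolP[x gx] imax.
exists (F i); split; first by exists x; rewrite gx.
by move=> y; apply: imax; apply/asboolP; exists y.
Qed.

(** The suffix map is bounded by the heights of the towers of the next
    partition, so it factors through a finite type. *)
Lemma suffix_is_max {R : realType} {X : topologicalType} {T : X -> X}
    (P : nat -> ckr_partition T) n (F : 'cV[nat]_(ckr_C (P n)) -> R) (x0 : X) :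
  exists m, is_max (fun x => F (suffix_map P n x)) m.
Proof.
pose M := (\max_k ckr_h (P n.+1) k)%N.
pose code x : {ffun 'I_(ckr_C (P n)) -> 'I_M.+1} :=
  [ffun k => inord (suffix_map P n x k 0)].
have [m hm] := finite_range_is_max _ code (fun c => F (\col_k nat_of_ord (c k))) x0.
exists m; congr (is_max _ m): hm; apply/funext => x; congr F.
apply/colP => k; rewrite mxE ffunE inordK// ltnS suffix_mapE.
exact: leq_trans (visits_le _ _ _ _) (entrance_time_bounded _ _).
Qed.

Theorem proposition9 (R : realType) (X : topologicalType) (T : X -> X)
    (hT : cantor_system T) (hmin : minimal T)
    (P : nat -> ckr_partition T) (hP : KR_sequence P)
    (lambda : R[i]) (alpha : R) (hlambda : lambda = exp_2ipi alpha)
    (heig : continuous_eigenvalue T lambda) :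
  exists m : R^nat,
    (forall n, (2 <= n)%N ->
      is_max (fun x : X =>
        `| dot (nat_mx (suffix_map P n x))
               (dist_int_vec (alpha *: nat_mx (kr_P P n *m kr_H P 1%N))) |)
        (m n))
    /\ m @ \oo --> (0 : R).
Proof.
have [x0 _] := KR3 hP.
pose v n := dist_int_vec (alpha *: nat_mx (kr_P P n *m kr_H P 1%N)).
have /choice[m hm] n : exists m : R,
    is_max (fun x => `|dot (nat_mx (suffix_map P n x)) (v n)|) m.
  exact: (suffix_is_max P n (fun s => `|dot (nat_mx s) (v n)|) x0).
exists m; split=> [n _|]; first exact: hm.
rewrite hlambda in heig; apply/cvgrPdist_lt => e e0.
pose d := Num.min e 3^-1.
have d0 : 0 < d by rewrite lt_min e0 invr_gt0 ltr0n.
have [n hn] := return_sdist_lt P _ _ hT.2 hmin hP heig d0.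
exists n.+1 => // -[//|k] /= /ltnW nk; rewrite sub0r normrN.
have [[x <-] _] := hm k.+1; rewrite normr_id.
have Bx : ckr_base (P k.+1) (iter (entrance_time (P k.+2) x) T x).
  exact/(KR1 hP)/entrance_time_in.
have := sum_visits_sdist_lt _ _ _ d0 _ (hn _ nk) _ _ Bx.
rewrite ge_min lexx orbT => /(_ isT).
rewrite lt_min => /andP[+ _]; congr (`|_| < _).
rewrite /dot mxE; apply: eq_bigr => l _.
rewrite -suffix_mapE /v kr_P_height// -[LHS]mulr_natl.
congr (_ * _); first by rewrite 2![RHS]mxE.
by rewrite !mxE.
Qed.
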